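(* Let $T$ be a tree on $n\ge 4$ vertices with matching number $k$, where $1\le k\le\lfloor n/2\rfloor$, and let $0\le\alpha<1$. Then $\rho_{\alpha}(T)\le\rho_{\alpha}(A(n,k))$, with equality if and only if $T\cong A(n,k)$.
   Context: For a graph $H$ with adjacency matrix $A(H)$ and diagonal degree matrix $D(H)$, and $\alpha\in[0,1]$, define $A_{\alpha}(H)=\alpha D(H)+(1-\alpha)A(H)$, and let $\rho_{\alpha}(H)$ denote the spectral radius of $A_{\alpha}(H)$. The matching number of a graph is the maximum number of pairwise vertex-disjoint edges. For $n\ge 2k$, $A(n,k)$ is the tree on $n$ vertices obtained from the star $S_{n-k+1}$ (on $n-k+1$ vertices) by attaching a pendent edge (a new vertex adjacent to it) to each of $k-1$ of its non-central vertices. *)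

(* Defs.v *)
From mathcomp Require Import all_boot all_order all_algebra.
From mathcomp Require Import classical_sets reals.
From mathcomp Require Import complex.

Set Implicit Arguments.
Unset Strict Implicit.
Unset Printing Implicit Defensive.

Import Order.TTheory GRing.Theory Num.Theory.

Record sgraph (V : finType) := SGraph {
  adj :> rel V;
  adj_sym : symmetric adj;
  adj_irrefl : irreflexive adj }.

Section Graphs.
Variables (V : finType) (G : sgraph V).

Definition connected_graph : Prop := forall x y : V, connect G x y.

(* [ucycle] also accepts the empty sequence and, since [G] is symmetric, the
   two ends of an edge; hence the size condition. *)
Definition acyclic : Prop :=
  forall c : seq V, (3 <= size c)%N -> ~ ucycle G c.

Definition is_tree : Prop := [/\ (0 < #|V|)%N, connected_graph & acyclic].

Definition edges : {set {set V}} :=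
  [set [set p.1; p.2] | p : V * V & G p.1 p.2].

Definition is_matching (M : {set {set V}}) : bool :=
  (M \subset edges) && finset.trivIset M.

Definition matching_number : nat := \max_(M | is_matching M) #|M|.

Definition degree (x : V) : nat := #|[set y | G x y]|.

End Graphs.

Definition isomorphic (V W : finType) (G : sgraph V) (H : sgraph W) : Prop :=
  exists2 f : V -> W, bijective f & forall x y, H (f x) (f y) = G x y.

(* The left summand is the vertex set of the star S_{n-k+1}, with centre [ord0];
   the new vertex [inr j] is pendent at the non-central vertex [j.+1].  When
   1 <= k and 2k <= n there are n vertices in all and [j.+1 <= k-1 <= n-k]. *)
Section Ank.
Variables n k : nat.

Definition Ank_vertex : finType := ('I_(n - k).+1 + 'I_k.-1)%type.

Definition Ank_adj (u v : Ank_vertex) : bool :=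
  match u, v with
  | inl x, inl y => (x == ord0) != (y == ord0)
  | inl x, inr j => x == j.+1 :> nat
  | inr j, inl x => x == j.+1 :> nat
  | inr _, inr _ => false
  end.

Lemma Ank_sym : symmetric Ank_adj.
Proof. by move=> [x|i] [y|j] //=; rewrite eq_sym. Qed.

Lemma Ank_irrefl : irreflexive Ank_adj.
Proof. by move=> [x|i] //=; rewrite eqxx. Qed.

Definition Ank : sgraph Ank_vertex := SGraph Ank_sym Ank_irrefl.

End Ank.

Local Open Scope ring_scope.

Section Spectral.
Variable R : realType.

(* The set is finite, and nonempty for [m > 0], so [sup] is a maximum. *)
Definition spectral_radius (m : nat) (M : 'M[R]_m) : R :=
  sup [set r : R | exists2 z : complex R,
         eigenvalue (map_mx (real_complex R) M) z & r = Normc.normc z]%classic.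

Variables (V : finType) (G : sgraph V).

(* Vertices index rows and columns through the enumeration of [V]. *)
Definition adjacency_mx : 'M[R]_#|V| :=
  \matrix_(i, j) (G (enum_val i) (enum_val j))%:R.

Definition degree_mx : 'M[R]_#|V| :=
  diag_mx (\row_i (degree G (enum_val i))%:R).

Definition A_alpha (alpha : R) : 'M[R]_#|V| :=
  alpha *: degree_mx + (1 - alpha) *: adjacency_mx.

Definition rho (alpha : R) : R := spectral_radius (A_alpha alpha).

End Spectral.

(* Main.v *)
(* By the spectral theorem, rho bounds the Rayleigh quotient of A_alpha, equality
   forces an eigenvector, and on a connected graph it is attained at a positive
   vector x.  Take such an x for T, root T at a vertex r maximising x, and choose
   k - 1 edges of a maximum matching that avoid r.  Keep these edges and reattach
   every vertex that is not the child in one of them to r: the result is a copy of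
   A(n,k), and no edge weight alpha (x_u^2 + x_v^2) + 2 (1 - alpha) x_u x_v has
   decreased.  If rho is unchanged, x is an eigenvector for both trees with the
   same eigenvalue; since the neighbours of r in T are also neighbours of r in the
   copy, comparing the two eigenvalue equations at r shows that nothing moved. *)
Require Import Defs.
From mathcomp Require Import all_boot all_order all_algebra reals.
From mathcomp Require Import complex spectral ring lra zify.
Set Implicit Arguments.
Unset Strict Implicit.
Unset Printing Implicit Defensive.
Import Order.TTheory GRing.Theory Num.Theory.
Local Open Scope ring_scope.

(** * Spectral radius and Rayleigh quotient of a real symmetric matrix *)

Section SymmetricSpectrum.
Variables (R : realType) (m : nat) (M : 'M[R]_m).
Hypotheses (m_gt0 : (0 < m)%N) (M_sym : M^T = M).

Let Mc : 'M[R[i]]_m := map_mx (real_complex R) M.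
Let P := spectralmx Mc.
Let d := spectral_diag Mc.
Let rho := spectral_radius M.

Local Open Scope sesquilinear_scope.

Let Pt : P *m P^t* = 1%:M.
Proof. by apply/unitarymxP/spectral_unitarymx. Qed.

Let tP : P^t* *m P = 1%:M.
Proof. exact: mulmx1C Pt. Qed.

Let Mc_herm : Mc \is hermsymmx.
Proof.
apply: realsym_hermsym.
  apply/is_hermitianmxP; rewrite expr0 scale1r; apply/matrixP=> i j.
  by rewrite !mxE -{1}M_sym mxE.
apply/mxOverP=> i j; rewrite !mxE.
by rewrite realE !lecR -realE num_real.
Qed.

Let McE : Mc = P^t* *m diag_mx d *m P.
Proof.
have /orthomx_spectralP {1}-> := hermitian_normalmx Mc_herm.
by rewrite invmx_unitary ?spectral_unitarymx.
Qed.

Let normcC (z : R[i]) : (Normc.normc z)%:C%C = `|z|.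
Proof. by rewrite normc_def; case: z. Qed.

Let eigenvalueE z : eigenvalue Mc z -> exists i, z = d 0 i.
Proof.
case/eigenvalueP=> v vM v0.
have wD : (v *m P^t*) *m diag_mx d = z *: (v *m P^t*).
  by rewrite scalemxAl -vM McE !mulmxA -[RHS]mulmxA Pt mulmx1.
have w0 : v *m P^t* != 0.
  apply: contra v0 => /eqP w0.
  by rewrite -[v]mulmx1 -tP mulmxA w0 mul0mx.
have [i wi] : exists i, (v *m P^t*) 0 i != 0 by apply/rV0Pn.
exists i; have := congr1 (fun w : 'rV_m => w 0 i) wD.
rewrite mul_mx_diag !mxE => h.
apply: (mulfI wi); rewrite [LHS]mulrC; symmetry.
by move: h; rewrite !mxE.
Qed.

Let row_eigen i : row i P *m Mc = d 0 i *: row i P.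
Proof.
rewrite -row_mul McE !mulmxA Pt mul1mx.
by apply/rowP=> j; rewrite mxE mul_diag_mx !mxE.
Qed.

Let row_neq0 i : row i P != 0.
Proof.
apply/eqP=> h; have := congr1 (fun A : 'M_m => row i A) Pt.
rewrite row_mul h mul0mx => /rowP/(_ i); rewrite !mxE eqxx => /esym/eqP.
by rewrite oner_eq0.
Qed.

Let eigen_d i : eigenvalue Mc (d 0 i).
Proof. by apply/eigenvalueP; exists (row i P). Qed.

Let dmax : exists i, forall j, Normc.normc (d 0 j) <= Normc.normc (d 0 i).
Proof.
have [i _ h] := @arg_maxP _ _ _ (Ordinal m_gt0) xpredT
  (fun i => Normc.normc (d 0 i)) isT.
by exists i => j; apply: h.
Qed.

(** By [eigenvalueE] and [eigen_d] the spectrum consists of the entries of [d], so the supremum is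
    the largest of finitely many moduli. *)
Let rhoE : exists2 i, rho = Normc.normc (d 0 i) &
  forall j, Normc.normc (d 0 j) <= rho.
Proof.
have [i hi] := dmax.
suff e : rho = Normc.normc (d 0 i) by exists i => // j; rewrite e.
apply/eqP; rewrite eq_le; apply/andP; split.
  apply: ge_sup; first by exists (Normc.normc (d 0 i)), (d 0 i).
  by move=> _ [z /eigenvalueE[j ->] ->].
apply: sup_upper_bound; last by exists (d 0 i).
split; first by exists (Normc.normc (d 0 i)), (d 0 i).
by exists (Normc.normc (d 0 i)) => _ [z /eigenvalueE[j ->] ->].
Qed.

Let d_real i : d 0 i \is Num.real.
Proof. by have /mxOverP/(_ 0 i) := hermitian_spectral_diag_real Mc_herm. Qed.

Let d_le i : d 0 i <= rho%:C%C.
Proof.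
have [_ _ h] := rhoE.
apply: (le_trans (real_ler_norm (d_real i))).
by rewrite -normcC lecR.
Qed.

Let Cx (x : 'rV[R]_m) : 'rV[R[i]]_m := map_mx (real_complex R) x.

Let CxT x : (Cx x)^t* = map_mx (real_complex R) x^T.
Proof. by apply/matrixP=> i j; rewrite !mxE; apply: conjc_real. Qed.

(** Parseval in the orthonormal eigenbasis formed by the rows of [P], with [w] the coordinates of
    [x]. By [d_le] each term on the right is nonnegative, which yields both Rayleigh lemmas. *)
Let defect (x : 'rV[R]_m) (w := Cx x *m P^t*) :
  (rho * (x *m x^T) 0 0 - (x *m M *m x^T) 0 0)%:C%C =
    \sum_i (rho%:C%C - d 0 i) * `|w 0 i| ^+ 2.
Proof.
have wt : w^t* = P *m (Cx x)^t* by rewrite trmx_mul map_mxM /= trmxCK.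
have e1 : ((x *m x^T) 0 0)%:C%C = (w *m w^t*) 0 0.
  by rewrite wt mulmxA -(mulmxA (Cx x)) tP mulmx1 CxT -map_mxM [RHS]mxE.
have e2 : ((x *m M *m x^T) 0 0)%:C%C = (w *m diag_mx d *m w^t*) 0 0.
  rewrite wt mulmxA -(mulmxA (Cx x)) -(mulmxA (Cx x)) -McE CxT.
  by rewrite -!map_mxM [RHS]mxE.
rewrite rmorphB rmorphM /= e1 e2.
rewrite mxE [X in _ - X]mxE mulr_sumr -sumrB; apply: eq_bigr => i _.
rewrite mul_mx_diag [(\matrix_(_, _) _) 0 i]mxE [w^t* i 0]mxE [w^T _ _]mxE normCK.
by rewrite mulrBl [w 0 i * d 0 i]mulrC -mulrA.
Qed.

Lemma rayleigh_le (x : 'rV[R]_m) :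
  (x *m M *m x^T) 0 0 <= rho * (x *m x^T) 0 0.
Proof.
rewrite -subr_ge0 -lecR defect; apply: sumr_ge0 => i _.
by rewrite mulr_ge0 ?subr_ge0 ?exprn_ge0.
Qed.

(** A zero sum of nonnegative terms makes [w] vanish wherever [d 0 i] differs from [rho], so
    [diag_mx d] scales [w] by [rho]; changing basis back gives the claim. *)
Lemma rayleigh_eq (x : 'rV[R]_m) :
  (x *m M *m x^T) 0 0 = rho * (x *m x^T) 0 0 -> x *m M = rho *: x.
Proof.
move=> h; have := defect x; rewrite h subrr => /esym/eqP.
set w := _ *m P^t*; rewrite psumr_eq0 => [/allP hw|i _]; last first.
  by rewrite mulr_ge0 ?subr_ge0 ?exprn_ge0.
have wD : w *m diag_mx d = rho%:C%C *: w.
  apply/rowP=> i; have := hw i (mem_index_enum _).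
  rewrite mul_mx_diag !mxE mulf_eq0 subr_eq0 expf_eq0 normr_eq0 /=.
  by rewrite mulrC => /orP[/eqP->|/eqP->] //; rewrite !mulr0.
have : Cx x *m Mc = rho%:C%C *: Cx x.
  by rewrite McE !mulmxA -/w wD -scalemxAl -mulmxA tP mulmx1.
rewrite -map_mxM -map_mxZ => /matrixP hx; apply/matrixP => i j.
by have := hx i j; rewrite !mxE => /complexI.
Qed.

(** Perron-Frobenius argument: [x] collects the moduli of an eigenvector whose eigenvalue has
    modulus [rho]. By the triangle inequality this can only raise the form, and [rayleigh_le] caps
    it. *)
Lemma nonneg_top_eigenvector : (forall i j, 0 <= M i j) ->
  exists x : 'rV[R]_m, [/\ forall i, 0 <= x 0 i, x != 0 &
    (x *m M *m x^T) 0 0 = rho * (x *m x^T) 0 0].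
Proof.
move=> M_ge0; have [i0 rhoi _] := rhoE.
have [v vE] : exists v, v = row i0 P by exists (row i0 P).
have [x xE] : exists x : 'rV[R]_m, forall i, (x 0 i)%:C%C = `|v 0 i|.
  by exists (\row_i Normc.normc (v 0 i)) => i; rewrite mxE normcC.
exists x; split.
- by move=> i; rewrite -lecR xE normr_ge0.
- apply: contra (row_neq0 i0) => /eqP x0; rewrite -vE; apply/eqP/rowP=> i.
  have := xE i; rewrite x0 mxE => /esym/eqP.
  by rewrite normr_eq0 => /eqP->; rewrite mxE.
apply/eqP; rewrite eq_le rayleigh_le /=.
have e1 : ((x *m x^T) 0 0)%:C%C = (v *m v^t*) 0 0.
  rewrite mxE [RHS]mxE rmorph_sum; apply: eq_bigr => i _.
  by rewrite rmorphM /= [x^T _ _]mxE xE [v^t* _ _]mxE [v^T _ _]mxE -normCK expr2.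
rewrite -lecR rmorphM /= e1 rhoi normcC.
have sZ (A : 'M[R[i]]_1) c : (c *: A) 0 0 = c * A 0 0 by rewrite mxE.
have -> : `|d 0 i0| * (v *m v^t*) 0 0 = `|(v *m Mc *m v^t*) 0 0|.
  rewrite vE row_eigen -vE -scalemxAl sZ normrM; congr (_ * _).
  by rewrite ger0_norm // -e1 lecR mxE sumr_ge0 // => i _; rewrite mxE -expr2 sqr_ge0.
rewrite [(v *m Mc *m _) 0 0]mxE; apply: (le_trans (ler_norm_sum _ _ _)).
rewrite mxE rmorph_sum; apply: ler_sum => j _.
rewrite normrM rmorphM /= [x^T _ _]mxE xE [v^t* _ _]mxE [v^T _ _]mxE norm_conjC.
apply: ler_wpM2r; rewrite ?normr_ge0 //.
rewrite [(v *m Mc) 0 j]mxE; apply: (le_trans (ler_norm_sum _ _ _)).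
rewrite mxE rmorph_sum; apply: ler_sum => i _.
have M0 : 0 <= (M i j)%:C%C by rewrite ler0c.
by rewrite normrM rmorphM /= xE [Mc _ _]mxE (ger0_norm M0).
Qed.

End SymmetricSpectrum.

(** * Parent functions of rooted trees *)

(** No condition falls on [p r]. The second clause forbids mutual parents and, for [u = v], fixed
    points of [p], so each edge belongs to exactly one child. *)
Definition parent_structure (V : finType) (G : sgraph V) (r : V) (p : V -> V) :
    Prop :=
  (forall u v, G u v = (u != r) && (p u == v) || (v != r) && (p v == u)) /\
  (forall u v, u != r -> v != r -> p u = v -> p v != u).

Section TreeParent.
Variables (V : finType) (G : sgraph V) (r : V).
Hypothesis G_tree : is_tree G.

Let inside (S : {set V}) : rel V := [rel a b | [&& a \in S, b \in S & G a b]].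

Let inside_sym S : connect_sym (inside S).
Proof. by apply: sym_connect_sym => a b; rewrite /inside /= adj_sym andbCA. Qed.

(** Invariant for growing a tree from [r]. Connectedness is asked inside [S], so that a path between
    two vertices of [S] avoids every vertex outside. *)
Let partial_parent (S : {set V}) (p : V -> V) : Prop :=
  [/\ r \in S, forall u, u \in S -> connect (inside S) u r,
   forall u, u \in S -> u != r -> p u \in S,
   {in S &, forall u v,
      G u v = (u != r) && (p u == v) || (v != r) && (p v == u)} &
   {in S &, forall u v, u != r -> v != r -> p u = v -> p v != u}].

(** If no edge left [S], every path from [r] would stay in [S], against connectedness. *)
Lemma boundary_edge (S : {set V}) : r \in S -> S != setT ->
  exists w v, [/\ w \in S, v \notin S & G w v].
Proof.
case: G_tree => _ conn _ rS ST.
have [/exists_inP[w wS /exists_inP[v vS Gwv]]|h] :=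
  boolP [exists w in S, exists v in ~: S, G w v].
  by exists w, v; rewrite wS Gwv; move: vS; rewrite inE.
case/eqP: ST; apply/setP=> z; rewrite inE.
case/connectP: (conn r z) => q; elim: q r rS => [|a q IHq] b bS /=.
  by move=> _ ->.
case/andP=> Gba pth; apply: IHq => //; apply: contraNT h => aS.
by apply/exists_inP; exists b => //; apply/exists_inP; exists a; rewrite ?inE.
Qed.

(* Two neighbours of [v] in [S] would close a cycle through [v]. *)
Lemma boundary_edge_unique (S : {set V}) v w w' :
  (forall u, u \in S -> connect (inside S) u r) ->
  w \in S -> w' \in S -> v \notin S -> G w v -> G w' v -> w' = w.
Proof.
move=> conS wS w'S vS Gwv Gw'v; apply/eqP/negPn/negP=> ww'.
have : connect (inside S) w w'.
  by apply: connect_trans (conS _ wS) _; rewrite inside_sym conS.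
case/connectP=> q0 /shortenP[q pth uq _] lst.
case: G_tree => _ _ /(_ (v :: w :: q)); apply.
  (* [q] is nonempty because [w'] differs from [w], so the cycle has at least three vertices. *)
  by case: q pth uq lst ww' => [|//] _ _ /= ->; rewrite eqxx.
have qS : {subset q <= S}.
  elim: q w pth {uq lst ww' wS Gwv} => // a q IHq b /= /andP[/and3P[_ aS _] pth] z.
  by rewrite inE => /orP[/eqP->//|]; apply: IHq pth z.
have sub : subrel (inside S) G by move=> a b /and3P[].
rewrite /ucycle cons_uniq uq andbT /= rcons_path (sub_path sub pth) -lst.
rewrite adj_sym Gwv Gw'v /=; apply: contra vS.
by rewrite inE => /orP[/eqP->//|/qS].
Qed.

(** Each step adds a vertex [v] adjacent to some [w] in [S] and makes [w] its parent. By acyclicity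
    [w] is the only neighbour of [v] in [S], so the description of the edges extends. *)
Let partial_parentS m : (m < #|V|)%N ->
  exists (S : {set V}) p, #|S| = m.+1 /\ partial_parent S p.
Proof.
elim: m => [_|m IHm ltm].
  exists [set r], id; rewrite cards1; split=> //; split=> [|u|u|u v|u v]; rewrite !inE.
  - by [].
  - by move/eqP->; apply: connect0.
  - by move->.
  - by move=> /eqP-> /eqP->; rewrite adj_irrefl !eqxx.
  - by move=> /eqP->; rewrite eqxx.
have [S [p [cS [rS conS pS GS exclS]]]] := IHm (ltnW ltm).
have [|w [v [wS vS Gwv]]] := boundary_edge rS.
  by apply: contraTneq ltm => ST; rewrite -cardsT -ST cS ltnn.
have uniq_w a : a \in S -> G a v = (a == w).
  move=> aS; apply/idP/eqP => [Gav|-> //].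
  exact: boundary_edge_unique conS wS aS vS Gwv Gav.
have nv a : a \in S -> (a == v) = false by move=> aS; apply: contraNF vS => /eqP<-.
have rv : (v == r) = false by rewrite eq_sym nv.
exists (v |: S), (fun u => if u == v then w else p u).
rewrite cardsU1 vS cS; split=> //; split.
- by rewrite in_setU1 rS orbT.
- have sub : subrel (connect (inside S)) (connect (inside (v |: S))).
    apply: connect_sub => a b /and3P[aS bS Gab]; apply: connect1.
    by rewrite /inside /= !in_setU1 aS bS Gab !orbT.
  move=> u; rewrite in_setU1 => /predU1P[->|uS]; last by apply: sub; apply: conS.
  apply: connect_trans (sub _ _ (conS _ wS)); apply: connect1.
  by rewrite /inside /= !in_setU1 eqxx wS orbT adj_sym Gwv.
- move=> u; rewrite !in_setU1 => /predU1P[-> _|uS ur]; first by rewrite eqxx wS orbT.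
  by rewrite (nv u) // pS ?orbT.
- move=> a b; rewrite !in_setU1 => /predU1P[->|aS] /predU1P[->|bS].
  + by rewrite adj_irrefl eqxx (nv w) // !andbF.
  + rewrite eqxx rv (nv b) // adj_sym uniq_w //= [b == w]eq_sym.
    have [->|br] := eqVneq b r; first by rewrite /= orbF.
    by rewrite nv ?pS // orbF.
  + rewrite eqxx rv (nv a) // uniq_w //= [a == w]eq_sym.
    have [->|ar] := eqVneq a r; first by rewrite /=.
    by rewrite nv ?pS.
  + by rewrite (nv a) // (nv b) // GS.
- move=> a b; rewrite !in_setU1 => /predU1P[->|aS] /predU1P[->|bS].
  + by rewrite eqxx => _ _ /eqP; rewrite nv.
  + by rewrite eqxx (nv b) // => _ br _; rewrite (nv (p b)) // pS.
  + by rewrite eqxx (nv a) // => ar _ /eqP; rewrite (nv (p a)) // pS.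
  + by rewrite (nv a) // (nv b) //; apply: exclS.
Qed.

Lemma tree_parent : exists p, parent_structure G r p.
Proof.
case: (G_tree) => V0 _ _.
have [|S [p [cS [_ _ _ GS exclS]]]] := @partial_parentS #|V|.-1.
  by rewrite prednK.
have ST u : u \in S.
  suff -> : S = setT by rewrite inE.
  by apply/eqP; rewrite eqEcard subsetT cardsT cS prednK // leqnn.
by exists p; split=> u v; [apply: GS | apply: exclS].
Qed.

End TreeParent.

(** * The quadratic form of [A_alpha] on functions of the vertices *)

Section GraphForms.
Variables (R : realType) (alpha : R).
Implicit Types (V W : finType).

(** The coordinate at [u] of the matrix applied to [x], with the degree term spread over the
    neighbours so that each neighbour contributes one term. *)
Definition A_alpha_act V (G : sgraph V) (x : V -> R) (u : V) : R :=
  \sum_v (G u v)%:R * (alpha * x u + (1 - alpha) * x v).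

Definition qform V (G : sgraph V) (x : V -> R) : R :=
  \sum_u x u * A_alpha_act G x u.

Definition sqnorm V (x : V -> R) : R := \sum_u x u ^+ 2.

Let vec V (x : V -> R) : 'rV[R]_#|V| := \row_i x (enum_val i).

Lemma sum_enum_val V (F : V -> R) : \sum_(i < #|V|) F (enum_val i) = \sum_u F u.
Proof. by rewrite [RHS](reindex _ (onW_bij _ (@enum_val_bij V))). Qed.

Lemma degreeE V (G : sgraph V) u : (degree G u)%:R = \sum_v (G u v)%:R :> R.
Proof.
rewrite /degree -sum1_card natr_sum big_mkcond /=.
by apply: eq_bigr => v _; rewrite inE; case: (G u v).
Qed.

Lemma vec_A_alpha V (G : sgraph V) x i :
  (vec x *m A_alpha G alpha) 0 i = A_alpha_act G x (enum_val i).
Proof.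
rewrite mxE /A_alpha_act.
under eq_bigr => j _ do rewrite !mxE mulrDr.
under [RHS]eq_bigr => j _ do rewrite mulrDr.
rewrite !big_split /=; congr (_ + _).
  rewrite (bigD1 i) //= eqxx big1 => [|j /negPf ji]; last first.
    by rewrite ji mulr0n !mulr0.
  by rewrite addr0 mulr1n degreeE -mulr_suml; ring.
rewrite -[RHS]sum_enum_val; apply: eq_bigr => j _.
by rewrite adj_sym; ring.
Qed.

Lemma vec_qform V (G : sgraph V) x :
  (vec x *m A_alpha G alpha *m (vec x)^T) 0 0 = qform G x.
Proof.
rewrite mxE -[RHS]sum_enum_val; apply: eq_bigr => i _.
by rewrite vec_A_alpha !mxE mulrC.
Qed.

Lemma vec_sqnorm V (x : V -> R) : (vec x *m (vec x)^T) 0 0 = sqnorm x.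
Proof.
rewrite mxE -[RHS]sum_enum_val; apply: eq_bigr => i _.
by rewrite !mxE expr2.
Qed.

Lemma A_alpha_sym V (G : sgraph V) : (A_alpha G alpha)^T = A_alpha G alpha.
Proof.
apply/matrixP=> i j; rewrite !mxE adj_sym eq_sym.
by case: eqVneq => [->|].
Qed.

Lemma qform_le V (G : sgraph V) (x : V -> R) :
  (0 < #|V|)%N -> qform G x <= rho G alpha * sqnorm x.
Proof.
move=> V0; rewrite -vec_qform -vec_sqnorm.
exact: rayleigh_le V0 (A_alpha_sym G) _.
Qed.

Lemma qform_eq V (G : sgraph V) (x : V -> R) u : (0 < #|V|)%N ->
  qform G x = rho G alpha * sqnorm x -> A_alpha_act G x u = rho G alpha * x u.
Proof.
move=> V0; rewrite -vec_qform -vec_sqnorm.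
move/(rayleigh_eq V0 (A_alpha_sym G))/rowP/(_ (enum_rank u)).
by rewrite vec_A_alpha !mxE enum_rankK.
Qed.

Hypothesis alpha01 : 0 <= alpha < 1.

Lemma nonneg_top_vector V (G : sgraph V) : (0 < #|V|)%N ->
  exists x : V -> R, [/\ forall u, 0 <= x u, exists u, x u != 0 &
    qform G x = rho G alpha * sqnorm x].
Proof.
move=> V0; have /andP[a0 a1] := alpha01.
have [|y [y0 yn ye]] := nonneg_top_eigenvector V0 (A_alpha_sym G).
  move=> i j; rewrite !mxE addr_ge0 ?mulr_ge0 ?subr_ge0 ?(ltW a1) //.
  by rewrite mulrn_wge0.
pose x u := y 0 (enum_rank u).
have yE : y = vec x by apply/rowP=> i; rewrite mxE /x enum_valK.
exists x; split; first by move=> u; apply: y0.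
  have /rV0Pn[i yi] := yn; exists (enum_val i).
  by rewrite /x enum_valK.
by rewrite -vec_qform -vec_sqnorm -yE.
Qed.

(** At a zero of [x] the eigenvalue equation is a vanishing sum of nonnegative terms; as [1 - alpha]
    is positive, all neighbours are zeros too. Zeros would thus spread along a path to [u0]. *)
Lemma pos_top_vector V (G : sgraph V) : (0 < #|V|)%N -> connected_graph G ->
  exists x : V -> R, (forall u, 0 < x u) /\ qform G x = rho G alpha * sqnorm x.
Proof.
move=> V0 conn; have /andP[a0 a1] := alpha01.
have [x [x0 [u0 xu0] xe]] := nonneg_top_vector G V0.
exists x; split=> // u; rewrite lt_neqAle x0 andbT eq_sym.
apply/negP=> /eqP xu; case/connectP: (conn u u0) xu0 => p.
elim: p u xu => [|v p IHp] u xu /= => [_ ->|/andP[Guv pth] lst].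
  by rewrite xu eqxx.
apply: (IHp v) => //; have := qform_eq u V0 xe.
rewrite xu mulr0 /A_alpha_act => /eqP; rewrite psumr_eq0 => [/allP h|w _].
  have := h v (mem_index_enum _).
  rewrite Guv mul1r xu mulr0 add0r mulf_eq0 => /implyP/(_ isT)/orP[/eqP|/eqP//].
  lra.
by rewrite xu mulr0 add0r !mulr_ge0 // subr_ge0 ltW.
Qed.

Lemma sqnorm_gt0 V (x : V -> R) u : x u != 0 -> 0 < sqnorm x.
Proof.
move=> xu; rewrite /sqnorm (bigD1 u) //=.
rewrite ltr_wpDr ?sumr_ge0 // => [i _|]; first exact: sqr_ge0.
by rewrite exprn_even_gt0.
Qed.

Lemma sqnorm_reindex V W (g : W -> V) (x : V -> R) :
  bijective g -> sqnorm (x \o g) = sqnorm x.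
Proof. by move=> bg; rewrite [RHS](reindex g) //; apply: onW_bij. Qed.

Lemma qform_reindex V W (G : sgraph V) (H : sgraph W) (g : W -> V) x :
  bijective g -> (forall a b, G (g a) (g b) = H a b) ->
  qform H (x \o g) = qform G x.
Proof.
move=> bg gG; rewrite [RHS](reindex g) /=; last exact: onW_bij.
apply: eq_bigr => a _; congr (_ * _).
rewrite [RHS](reindex g) /=; last exact: onW_bij.
by apply: eq_bigr => b _; rewrite gG.
Qed.

(** A top vector of [G], transported to [H], is a test vector with the same Rayleigh quotient. *)
Lemma rho_le_iso V W (G : sgraph V) (H : sgraph W) :
  (0 < #|V|)%N -> isomorphic G H -> rho G alpha <= rho H alpha.
Proof.
move=> V0 [f bf fG]; have W0 : (0 < #|W|)%N by rewrite -(bij_eq_card bf).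
have [x [_ [u xu] xe]] := nonneg_top_vector G V0.
case: bf => g fK gK; have bg : bijective g by exists f.
have gG a b : G (g a) (g b) = H a b by rewrite -fG !gK.
rewrite -(ler_pM2r (sqnorm_gt0 xu)) -xe -(qform_reindex _ bg gG).
by rewrite -(sqnorm_reindex _ bg) qform_le.
Qed.

Lemma isomorphic_sym V W (G : sgraph V) (H : sgraph W) :
  isomorphic G H -> isomorphic H G.
Proof.
case=> f [g fK gK] fG; exists g; first by exists f.
by move=> a b; rewrite -fG !gK.
Qed.

Definition edge_weight (a b : R) : R :=
  alpha * (a ^+ 2 + b ^+ 2) + 2 * (1 - alpha) * a * b.

(** The two disjuncts describing an edge exclude each other, so its indicator is a sum of two.
    Exchanging the sums in the second part pairs [h u (p u)] with [h (p u) u]. *)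
Lemma qform_parent V (G : sgraph V) r p x : parent_structure G r p ->
  qform G x = \sum_(u | u != r) edge_weight (x u) (x (p u)).
Proof.
case=> GE excl; pose h u v := x u * (alpha * x u + (1 - alpha) * x v).
have -> : qform G x = \sum_u \sum_v
    (((u != r) && (p u == v))%:R * h u v + ((v != r) && (p v == u))%:R * h u v).
  apply: eq_bigr => u _; rewrite mulr_sumr; apply: eq_bigr => v _.
  rewrite GE mulrCA -mulrDl; congr (_ * _).
  have [/= ur|] := boolP (u != r); have [/= vr|] := boolP (v != r);
    rewrite ?add0r ?addr0 ?orbF //.
  have [/= puv|] := eqVneq (p u) v; last by rewrite add0r.
  by rewrite (negPf (excl _ _ ur vr puv)) addr0.
under eq_bigr => u _ do rewrite big_split.
rewrite big_split /= [X in _ + X]exchange_big /= -big_split [RHS]big_mkcond.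
apply: eq_bigr => u _ /=; have [ur|ur] /= := boolP (u == r).
  by rewrite !big1 ?addr0 // => v _; rewrite mul0r.
rewrite (bigD1 (p u)) //= eqxx big1 => [|v /negPf]; last first.
  by rewrite eq_sym => ->; rewrite mul0r.
rewrite (bigD1 (p u)) //= eqxx big1 => [|v /negPf]; last first.
  by rewrite eq_sym => ->; rewrite mul0r.
by rewrite !mul1r !addr0 /h /edge_weight; ring.
Qed.

Lemma edge_weight_le a b c : 0 <= a -> 0 <= b -> b <= c ->
  edge_weight a b <= edge_weight a c.
Proof.
move=> a0 b0 bc; have /andP[al0 al1] := alpha01.
apply: lerD; last by rewrite ler_wpM2l ?mulr_ge0 // subr_ge0 ltW.
by rewrite ler_wpM2l // lerD2l ler_pXn2r ?nnegrE // (le_trans b0).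
Qed.

End GraphForms.

(** * Matching edges seen from their child ends *)

Section MatchingChildren.
Variables (V : finType) (G : sgraph V) (r : V) (p : V -> V).
Hypothesis pG : parent_structure G r p.

Lemma max_matching : exists2 M, is_matching G M & #|M| = matching_number G.
Proof.
have [|M MM e] := @eq_bigmax_cond _ (is_matching G) (fun M => #|M|).
  apply/card_gt0P; exists set0; rewrite unfold_in /is_matching sub0set.
  by apply/trivIsetP=> A B; rewrite inE.
by exists M => //; rewrite -e.
Qed.

(** At most one edge of a matching contains [r], so deleting one edge suffices. *)
Lemma matching_avoiding (M : {set {set V}}) : is_matching G M ->
  exists2 N, is_matching G N & #|N| = #|M|.-1 /\ forall e, e \in N -> r \notin e.
Proof.
case/andP=> Medge Mtriv.
have [M0|[B0 B0M]] := set_0Vmem M.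
  exists set0; last by rewrite M0 cards0; split=> // e; rewrite inE.
  by rewrite -M0 /is_matching Medge.
have [B BM hB] : exists2 B, B \in M & forall e, e \in M -> r \in e -> e = B.
  have [/exists_inP[B BM rB]|h] := boolP [exists e in M, r \in e].
    by exists B => // e eM re; rewrite -(def_pblock Mtriv BM rB) (def_pblock Mtriv eM re).
  (* No edge contains [r]; an arbitrary edge is deleted so that the size is still [#|M|.-1]. *)
  exists B0 => // e eM re; case/negP: h; by apply/exists_inP; exists e.
exists (M :\ B).
  rewrite /is_matching (subset_trans (subsetDl _ _)) //=.
  by apply: trivIsetS Mtriv; apply: subsetDl.
rewrite (cardsD1 B M) BM; split=> // e; rewrite !inE => /andP[eB eM].
by apply: contra eB => re; rewrite (hB _ eM re).
Qed.

(** [C] holds the child ends of matching edges avoiding [r]. Disjointness of these edges separates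
    [C] from its parents and the parents from each other. *)
Lemma matching_children : exists C : {set V},
  [/\ #|C| = (matching_number G).-1, r \notin C, forall v, v \in C -> p v != r,
      forall v, v \in C -> p v \notin C & {in C &, injective p}].
Proof.
have [M0 M0m <-] := max_matching.
have [M /andP[Medge Mtriv] [<- Mr]] := matching_avoiding M0m.
have [GE excl] := pG.
have meet e f z : e \in M -> f \in M -> z \in e -> z \in f -> e = f.
  by move=> eM fM ze zf; rewrite -(def_pblock Mtriv eM ze) (def_pblock Mtriv fM zf).
pose C := [set v | (v != r) && ([set v; p v] \in M)].
have pr v : v \in C -> p v != r.
  rewrite inE => /andP[_ /Mr]; apply: contra => /eqP->; exact: set22.
(* Distinct vertices with the same parent edge would be each other's parent. *)
have edge_inj : {in C &, injective (fun v => [set v; p v])}.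
  move=> u v uC vC uv.
  have : u \in [set v; p v] by rewrite -uv set21.
  have : v \in [set u; p u] by rewrite uv set21.
  rewrite !inE => /orP[/eqP->//|/eqP vpu] /orP[/eqP//|/eqP upv].
  move: uC vC; rewrite !inE => /andP[ur _] /andP[vr _].
  by case/eqP: (excl u v ur vr (esym vpu)).
have p_inj : {in C &, injective p}.
  move=> u v uC vC puv; apply: edge_inj => //.
  move: uC vC; rewrite !inE => /andP[_ uM] /andP[_ vM].
  by apply: (meet _ _ (p u)) => //; rewrite ?set22 // puv set22.
exists C; split=> //; last 1 first.
- move=> v vC; apply/negP=> pvC.
  (* The edges of [v] and [p v] share [p v], so they coincide, and [edge_inj] gives a fixed point of
     [p]. *)
  have e : p v = v.
    apply: edge_inj => //; move: vC pvC; rewrite !inE => /andP[_ vM] /andP[_ pvM].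
    by apply: (meet _ _ (p v)) => //; rewrite ?set21 ?set22.
  move: vC; rewrite inE => /andP[vr _].
  by have /eqP := excl v v vr vr e.
- rewrite -(card_in_imset edge_inj); congr #|pred_of_set _|; apply/setP=> e.
  apply/imsetP/idP=> [[v]|eM]; first by rewrite inE => /andP[_ vM] ->.
  have /imsetP[[u v]] := subsetP Medge _ eM; rewrite inE /= GE => uv ee.
  case/orP: uv => /andP[ur /eqP puv].
    by exists u; rewrite ?inE ?ur puv -?ee.
  by exists v; rewrite ?inE ?ur puv setUC -?ee.
- by rewrite inE eqxx.
Qed.

End MatchingChildren.

(** * A(n,k) as a rooted tree, and its copy on the vertex set [V] *)

Section AnkParent.
Variables n k : nat.

Definition Ank_root : Ank_vertex n k := inl ord0.

(** [inord j.+1] is the intended star vertex once [k.-1 <= n - k]; out of range it would take a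
    default value. *)
Definition Ank_parent (a : Ank_vertex n k) : Ank_vertex n k :=
  if a is inr j then inl (inord j.+1) else Ank_root.

Lemma Ank_parent_structure :
  (k.-1 <= n - k)%N -> parent_structure (Ank n k) Ank_root Ank_parent.
Proof.
move=> kn; have inordE (j : 'I_k.-1) : (inord j.+1 : 'I_(n - k).+1) = j.+1 :> nat.
  by rewrite inordK // ltnS (leq_trans (ltn_ord j)).
split=> [[i|j] [i'|j']|[i|j] [i'|j']] //=.
- have -> : (inl i != Ank_root) = (i != ord0) by [].
  have -> : (inl i' != Ank_root) = (i' != ord0) by [].
  have inl_eq (a b : 'I_(n - k).+1) : (inl a == inl b :> Ank_vertex n k) = (a == b) by [].
  rewrite /Ank_root !inl_eq ![ord0 == _]eq_sym.
  by case: (i == ord0); case: (i' == ord0).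
- have -> : (inl (inord j'.+1) == inl i :> Ank_vertex n k) = (inord j'.+1 == i) by [].
  have -> : (Ank_root == inr j') = false by [].
  by rewrite andbF /= -val_eqE /= inordE eq_sym.
- have -> : (inl (inord j.+1) == inl i' :> Ank_vertex n k) = (inord j.+1 == i') by [].
  have -> : (Ank_root == inr j) = false by [].
  by rewrite andbF orbF /= -val_eqE /= inordE eq_sym.
- by move=> _ /eqP vr vE; case: vr.
Qed.

End AnkParent.

(* [C] is the set of pendent vertices of the copy of A(n,k), [p @: C] their
   neighbours. *)
Lemma Ank_labelling (V : finType) (n k : nat) (r : V) (p : V -> V) (C : {set V}) :
    #|V| = n -> (1 <= k <= n)%N -> #|C| = k.-1 -> r \notin C ->
    (forall v, v \in C -> p v != r) -> (forall v, v \in C -> p v \notin C) ->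
    {in C &, injective p} ->
  exists g : Ank_vertex n k -> V, [/\ bijective g, g (Ank_root n k) = r,
    forall a, g (Ank_parent a) = if g a \in C then p (g a) else r &
    (k.-1 <= n - k)%N].
Proof.
move=> cV /andP[k1 kn] cC rC pr pC p_inj.
(* [c] lists the pendent vertices and [L] the star: [r] at index 0, then the parents in the order of
   [c], so that the parent of entry [j] sits at index [j.+1], then the other vertices. *)
pose rest := enum (~: (r |: (C :|: p @: C))).
pose c := enum C; pose L := r :: map p c ++ rest.
have memc v : (v \in c) = (v \in C) by rewrite mem_enum.
have mempc v : (v \in map p c) = (v \in p @: C).
  apply/mapP/imsetP => -[w wC ->]; exists w => //; first by rewrite -memc.
  by rewrite memc.
have memrest v : (v \in rest) = [&& v != r, v \notin C & v \notin p @: C].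
  by rewrite mem_enum !inE !negb_or.
have uL : uniq (c ++ L).
  rewrite cat_uniq enum_uniq /= cat_uniq enum_uniq mem_cat mempc memrest eqxx.
  rewrite memc (negPf rC) /= orbF.
  rewrite map_inj_in_uniq ?enum_uniq => [/=|u v]; last by rewrite !memc; apply: p_inj.
  rewrite andbT; apply/and3P; split.
  - apply/hasPn=> v; rewrite mem_cat mempc memrest /= memc.
    by case/orP=> [/imsetP[w wC ->]|/and3P[]] //; apply: pC.
  - by apply/imsetP=> -[w wC e]; case/eqP: (pr w wC).
  - by apply/hasPn=> v; rewrite memrest /= mempc => /and3P[].
have allL v : v \in c ++ L.
  rewrite mem_cat memc inE mem_cat mempc memrest.
  by case: (v \in C); case: (v == r); case: (v \in p @: C).
have sc : size c = k.-1 by rewrite -cardE.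
have sL : size L = (n - k).+1.
  have : size (c ++ L) = n.
    by rewrite -cV cardE; apply/perm_size/uniq_perm; rewrite ?enum_uniq // => v;
      rewrite allL mem_enum.
  rewrite size_cat sc; lia.
(* The [n - k + 1] entries of [L] include [r] and the [k - 1] parents. *)
have kL : (k.-1 <= n - k)%N.
  by rewrite -ltnS -sL /= ltnS size_cat size_map sc leq_addr.
pose g (a : Ank_vertex n k) :=
  match a with inl i => nth r L i | inr j => nth r c j end.
have gr (j : 'I_k.-1) : nth r c j \in C by rewrite -memc mem_nth // sc.
have uc : uniq c by apply: enum_uniq.
move: (uL); rewrite cat_uniq => /and3P[_ /hasPn cL uL'].
have gl (i : 'I_(n - k).+1) : nth r L i \notin C.
  by rewrite -memc cL // mem_nth // sL.
have g_inj : injective g.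
  move=> [i|j] [i'|j'] /= e.
  - congr inl; apply/val_inj/eqP.
    by rewrite -(nth_uniq r _ _ uL') ?sL ?ltn_ord //; apply/eqP.
  - by case/negP: (gl i); rewrite e; apply: gr.
  - by case/negP: (gl i'); rewrite -e; apply: gr.
  - congr inr; apply/val_inj/eqP.
    by rewrite -(nth_uniq r _ _ uc) ?sc ?ltn_ord //; apply/eqP.
exists g; split=> //.
- apply: inj_card_bij g_inj _; rewrite cV card_sum !card_ord; lia.
- case=> [i|j]; first by rewrite /= (negPf (gl i)).
  rewrite /= gr inordK; last by rewrite ltnS (leq_trans (ltn_ord j)).
  by rewrite /= nth_cat size_map sc ltn_ord (nth_map r) ?sc.
Qed.

(** * Comparison of the two trees and the equality case *)

Lemma iso_of_parents (V W : finType) (G : sgraph V) (H : sgraph W)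
    (r : V) p (s : W) q (g : W -> V) :
    parent_structure G r p -> parent_structure H s q -> bijective g ->
    g s = r -> (forall a, a != s -> p (g a) = g (q a)) ->
  isomorphic H G.
Proof.
move=> [GE _] [HE _] bg gs pq; have inj := bij_inj bg.
exists g => // a b; rewrite GE HE -gs !(inj_eq inj).
by congr (_ || _); apply: andb_id2l => /pq->; rewrite (inj_eq inj).
Qed.

Theorem theorem3 (R : realType) (n k : nat) (alpha : R)
    (V : finType) (T : sgraph V)
    (hn : (4 <= n)%N) (hV : #|V| = n) (hT : is_tree T)
    (hk : (1 <= k <= n %/ 2)%N) (hmatch : matching_number T = k)
    (halpha : 0 <= alpha < 1) :
  rho T alpha <= rho (Ank n k) alpha /\
  (rho T alpha = rho (Ank n k) alpha <-> isomorphic T (Ank n k)).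
Proof.
have [V0 conn _] := hT; have /andP[al0 al1] := halpha.
have [x [x_gt0 xe]] := pos_top_vector halpha V0 conn.
have x_ge0 u : 0 <= x u := ltW (x_gt0 u).
have [v0 _] := card_gt0P V0.
have [r _ rmax] := @arg_maxP _ _ _ v0 xpredT x isT.
have [p pT] := tree_parent r hT.
have [C []] := matching_children pT; rewrite hmatch => cC rC pr pC p_inj.
have kn : (1 <= k <= n)%N by case/andP: hk => -> /leq_trans ->//; apply: leq_div.
have [g [bg gr gpar knk]] := Ank_labelling hV kn cC rC pr pC p_inj.
have pA := Ank_parent_structure knk.
have W0 : (0 < #|Ank_vertex n k|)%N by rewrite (bij_eq_card bg).
have g_inj := bij_inj bg.
have gE a : (g a != r) = (a != Ank_root n k) by rewrite -gr (inj_eq g_inj).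
(* Edges are matched by their child: its parent in the copy is either the old one or [r], where [x]
   is maximal. *)
have qle : qform alpha T x <= qform alpha (Ank n k) (x \o g).
  rewrite (qform_parent _ _ pT) (qform_parent _ _ pA).
  rewrite (reindex g) /=; last exact: onW_bij.
  under eq_bigl => a do rewrite gE.
  apply: ler_sum => a _; apply: edge_weight_le => //.
  by rewrite gpar; case: ifP => // _; apply: rmax.
have sqE := sqnorm_reindex x bg.
have sq0 : 0 < sqnorm x by apply: (@sqnorm_gt0 _ _ _ v0); rewrite gt_eqF.
have Ale := qform_le alpha (Ank n k) (x \o g) W0.
have le : rho T alpha <= rho (Ank n k) alpha.
  by rewrite -(ler_pM2r sq0) -xe -sqE (le_trans qle).
split=> //; split=> [e|iso]; last first.
  apply/eqP; rewrite eq_le le.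
  by rewrite (rho_le_iso halpha W0 (isomorphic_sym iso)).
apply: isomorphic_sym; apply: (iso_of_parents pT pA bg gr) => a ar.
(* Equal radii collapse the chain of inequalities, so the transported [x] is a top vector for
   A(n,k). *)
have qe : qform alpha (Ank n k) (x \o g) = rho (Ank n k) alpha * sqnorm (x \o g).
  by apply/eqP; rewrite eq_le Ale sqE -e -xe qle.
(* What a neighbour [v] contributes to the eigenvalue equation at [r]. Since it is positive, an
   additional neighbour would strictly raise the sum. *)
pose h v := alpha * x r + (1 - alpha) * x v.
have h_gt0 v : 0 < h v.
  by rewrite ltr_wpDl ?mulr_ge0 // mulr_gt0 ?subr_gt0.
have : A_alpha_act alpha (Ank n k) (x \o g) (Ank_root n k) = A_alpha_act alpha T x r.
  by rewrite (qform_eq _ W0 qe) (qform_eq _ V0 xe) /= gr e.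
rewrite /A_alpha_act [RHS](reindex g (onW_bij _ bg)).
have [TE _] := pT; have [AE _] := pA.
have adjT b : T r (g b) = (b != Ank_root n k) && (p (g b) == r).
  by rewrite TE eqxx /= gE.
have adjA b : Ank n k (Ank_root n k) b =
    (b != Ank_root n k) && (Ank_parent b == Ank_root n k).
  by rewrite AE eqxx.
have adjTA b : T r (g b) -> Ank n k (Ank_root n k) b.
  rewrite adjT adjA => /andP[-> /eqP pb] /=.
  rewrite -(inj_eq g_inj) gr gpar; case: ifP => // gbC.
  by rewrite pb.
(* By [adjTA] the difference of the two sums has nonnegative terms; being zero, it forces equal
   adjacency to the root. *)
move/eqP; rewrite -subr_eq0 -sumrB psumr_eq0 => [/allP/(_ a)|b _]; last first.
  rewrite /comp gr -mulrBl mulr_ge0 ?(ltW (h_gt0 _)) // subr_ge0 ler_nat.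
  by case Tb: (T r (g b)) => //; rewrite (adjTA _ Tb).
rewrite mem_index_enum /comp gr -mulrBl mulf_eq0.
rewrite [X in _ || X]gt_eqF ?h_gt0 // orbF => /(_ isT).
rewrite subr_eq0 eqr_nat adjT adjA ar /= gpar.
(* On [C] the parent was kept. Off [C] the vertex is adjacent to the root in the copy, hence also in
   [T], so its parent was already [r]. *)
have [gaC _|gaC] := boolP (g a \in C); first by [].
have -> : Ank_parent a == Ank_root n k.
  by rewrite -(inj_eq g_inj) gr gpar (negPf gaC).
by case: (p (g a) =P r).
Qed.
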